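(* Let $t\ge1$ be an integer, let $G$ be a connected $d$-transmission-regular graph on $n$ vertices, and let $D$ be its distance matrix, with eigenvalues $\tilde\lambda_1\ge\cdots\ge\tilde\lambda_n$ (with multiplicity). Then: (a) if $tn-d+\tilde\lambda_2>0$, then $\displaystyle \mathrm{eq}_t(G)\le\frac{(\tilde\lambda_2+t)n}{tn-d+\tilde\lambda_2}$; (b) if $tn-d+\tilde\lambda_n<0$, then $\displaystyle \mathrm{eq}_t(G)\le\frac{(\tilde\lambda_n+t)n}{tn-d+\tilde\lambda_n}$.
   Context: Graphs are finite, simple and undirected (with $n\ge 2$ so that $\tilde\lambda_2$ exists); $d(u,v)$ is the shortest-path distance, and the distance matrix $D$ has entries $D_{uv}=d(u,v)$. A graph is $d$-transmission-regular if every row of its distance matrix sums to the constant $d$. A set $S\subseteq V(G)$ is $t$-equidistant if $d(u,v)=t$ for all distinct $u,v\in S$, and $\mathrm{eq}_t(G)$ is the maximum size of a $t$-equidistant set of $G$. *)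

(* Defs.v *)
From mathcomp Require Import all_boot all_order all_algebra.
Set Implicit Arguments.
Unset Strict Implicit.
Unset Printing Implicit Defensive.
Import Order.TTheory GRing.Theory Num.Theory.
Local Open Scope ring_scope.

(* A simple graph on the finite vertex type T is a symmetric irreflexive
   relation e : rel T. *)

Definition connected_graph (T : finType) (e : rel T) : Prop :=
  forall u v : T, connect e u v.

(* The least k such that some walk with k edges goes from u to v. A shortest
   walk has fewer than #|T| edges; the value is #|T| when v is not reachable
   from u. *)
Definition gdist (T : finType) (e : rel T) (u v : T) : nat :=
  find (fun k => [exists p : k.-tuple T, path e u p && (last u p == v)])
       (iota 0 #|T|).

(* Rows and columns are indexed through the enumeration of T. *)
Definition distance_mx (R : pzSemiRingType) (T : finType) (e : rel T) :
    'M[R]_#|T| :=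
  \matrix_(i, j) (gdist e (enum_val i) (enum_val j))%:R.

Definition transmission_regular (R : pzSemiRingType) (T : finType) (e : rel T)
    (d : R) : Prop :=
  forall i, \sum_j distance_mx R e i j = d.

Definition equidistant (T : finType) (e : rel T) (t : nat) (S : {set T}) :
    bool :=
  [forall u in S, forall v in S, (u != v) ==> (gdist e u v == t)].

Definition eq_num (T : finType) (e : rel T) (t : nat) : nat :=
  \max_(S : {set T} | equidistant e t S) #|S|.

(* s lists the eigenvalues of A with algebraic multiplicity in nonincreasing
   order; for a symmetric A over a real closed field there is exactly one such
   s, of size n. Indices start at 0: the k-th largest eigenvalue is s`_k.-1. *)
Definition ordered_spectrum (R : rcfType) (n : nat) (A : 'M[R]_n) (s : seq R) :
    Prop :=
  sorted >=%R s /\ char_poly A = \prod_(x <- s) ('X - x%:P).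

(* Main.v *)
(* Write a t-equidistant set S of size m through its indicator vector x, and let
   y = x - (m/n) 1, which is orthogonal to 1. Since 1 is an eigenvector of D for
   d, and d is the largest eigenvalue because D is nonnegative, y D y^T lies
   between lambda_n |y|^2 and lambda_2 |y|^2. Here |y|^2 = m - m^2/n and
   y D y^T = t m (m-1) - d m^2/n, and dividing by m gives both bounds.
   The spectral decomposition is that of D seen as a Hermitian matrix
   over R[i]. *)
Require Import Defs.
From mathcomp Require Import all_boot all_order all_algebra.
From mathcomp Require Import fingroup perm spectral sesquilinear complex ring.
Set Implicit Arguments.
Unset Strict Implicit.
Unset Printing Implicit Defensive.
Import Order.TTheory GRing.Theory Num.Theory.
Local Open Scope ring_scope.

(** * Ordered spectra *)

Lemma size_ordered_spectrum (R : rcfType) (n : nat) (A : 'M[R]_n) (s : seq R) :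
  ordered_spectrum A s -> size s = n.
Proof.
move=> [_ cpA]; have := size_char_poly A.
by rewrite cpA size_prod_XsubC => -[].
Qed.

Lemma ordered_spectrum_nth_le (R : rcfType) (n : nat) (A : 'M[R]_n)
    (s : seq R) (i j : nat) :
  ordered_spectrum A s -> (i <= j < n)%N -> s`_j <= s`_i.
Proof.
move=> specA /andP[le_ij lt_jn]; have [s_sort _] := specA.
by apply: (sorted_leq_nth ge_trans ge_refl _ s_sort);
  rewrite ?inE ?(size_ordered_spectrum specA) ?(leq_ltn_trans le_ij).
Qed.

Lemma mem_ordered_spectrum (R : rcfType) (n : nat) (A : 'M[R]_n) (s : seq R)
    (a : R) :
  ordered_spectrum A s -> eigenvalue A a = (a \in s).
Proof. by move=> [_ cpA]; rewrite eigenvalue_root_char cpA root_prod_XsubC. Qed.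

(** * Unitary diagonalisation of real symmetric matrices *)

Local Open Scope sesquilinear_scope.
Local Notation toC := (real_complex _).
Local Notation mxC := (map_mx (real_complex _)).

Lemma conj_real_complex (R : rcfType) (x : R) : (toC x)^* = toC x.
Proof. by apply/CrealP/complex_realP; exists x. Qed.

(** Over polynomials the relation reads [('X - A) U = U ('X - B)]. Taking determinants, [\det U]
    cancels because it is a nonzero constant. *)
Lemma char_poly_intertwine (F : fieldType) (n : nat) (A B U : 'M[F]_n) :
  U \in unitmx -> A *m U = U *m B -> char_poly A = char_poly B.
Proof.
move=> Uunit AU; pose V := map_mx polyC U.
have detV : \det V != 0.
  by rewrite det_map_mx polyC_eq0 -unitfE -unitmxE.
apply: (mulIf detV); rewrite [RHS]mulrC -!det_mulmx /char_poly_mx.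
congr (\det _); rewrite mulmxBl mulmxBr -!map_mxM AU.
by rewrite scalar_mxC.
Qed.

(** The columns of [U] form an orthonormal eigenbasis. The spectral theorem for normal matrices
    gives the eigenvalues in an uncontrolled order, so the columns are permuted to follow [s]. *)
Lemma symmetric_spectral (R : rcfType) (n : nat) (A : 'M[R]_n) (s : seq R) :
    A^T = A -> ordered_spectrum A s ->
  exists2 U : 'M[R[i]]_n, U \is unitarymx &
    mxC A *m U = U *m diag_mx (\row_i toC s`_i).
Proof.
move=> symA specA; have [_ cpA] := specA.
have normA : mxC A \is normalmx.
  apply/normalmxP; suff -> : (mxC A)^t* = mxC A by [].
  by apply/matrixP => i j; rewrite !mxE conj_real_complex -[in RHS]symA mxE.
have /orthomx_spectralP := normA.
set P := spectralmx _; set D := spectral_diag _ => defA.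
have Pu : P \is unitarymx by apply: spectral_unitarymx.
have Wu : P^t* \is unitarymx by rewrite trmxC_unitary.
have AW : mxC A *m P^t* = P^t* *m diag_mx D.
  by rewrite defA invmx_unitary // mulmxtVK.
(* Both lists are the roots, with multiplicity, of the characteristic polynomial of [mxC A], hence
   agree up to a permutation. *)
have cpD : perm_eq (map toC s) [tuple D 0 i | i < n].
  apply: prod_XsubC_eq; rewrite big_map.
  transitivity (map_poly toC (char_poly A)).
    by rewrite cpA rmorph_prod; apply: eq_bigr => x _; rewrite /= map_polyXsubC.
  rewrite map_char_poly (char_poly_intertwine _ AW) ?unitarymx_unit //.
  rewrite (char_poly_trig (diag_mx_is_trig _)) /= big_map big_enum /=.
  by apply: eq_bigr => i _; rewrite mxE eqxx.
have /tuple_permP[p sE] := cpD.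
have sn : size s = n := size_ordered_spectrum specA.
have {}sE (i : 'I_n) : toC s`_i = D 0 (p i).
  rewrite -(nth_map _ 0) ?sn // sE nth_mktuple.
  by rewrite tnth_mktuple.
exists (col_perm p (P^t*)).
  rewrite -trmxC_unitary; apply/row_unitarymxP => i j.
  have /row_unitarymxP/(_ (p i) (p j)) := Pu.
  rewrite (inj_eq perm_inj) => <-; rewrite !dotmxE !mxE.
  by apply: eq_bigr => k _; rewrite !mxE !conjCK.
apply/matrixP => i j; have /matrixP/(_ i (p j)) := AW.
rewrite !mul_mx_diag !mxE sE => <-.
by apply: eq_bigr => k _; rewrite !mxE.
Qed.

(** * Rayleigh bounds for the smallest and second largest eigenvalues *)

Section Rayleigh.
Variables (R : rcfType) (n : nat) (A : 'M[R]_n) (s : seq R).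
Hypotheses (symA : A^T = A) (specA : ordered_spectrum A s).

(* w_i is the squared modulus of the i-th coordinate of x in an orthonormal
   eigenbasis listed in the order of s. *)
Lemma rayleigh_weights (x : 'rV[R]_n) : exists w : 'I_n -> R,
  [/\ forall i, 0 <= w i,
      (x *m x^T) 0 0 = \sum_i w i,
      (x *m A *m x^T) 0 0 = \sum_(i < n) s`_i * w i &
      forall (u : 'rV[R]_n) (i : 'I_n),
        u != 0 -> u *m A = s`_0 *: u -> x *m u^T = 0 ->
        s`_1 < s`_0 -> s`_1 < s`_i -> w i = 0].
Proof.
have [U Uu AU] := symmetric_spectral symA specA.
pose z (y : 'rV[R]_n) := mxC y *m U.
have conjxC (y : 'rV[R]_n) : (mxC y)^t* = (mxC y)^T.
  by apply/matrixP => i j; rewrite !mxE conj_real_complex.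
have zz (y u : 'rV[R]_n) : toC ((y *m u^T) 0 0) = \sum_i z y 0 i * (z u 0 i)^*.
  transitivity ((z y *m (z u)^t*) 0 0); last first.
    by rewrite mxE; apply: eq_bigr => i _; rewrite !mxE.
  rewrite /z trmx_mul map_mxM mulmxA mulmxtVK // conjxC map_trmx -map_mxM.
  by rewrite [RHS]mxE.
have zA (y : 'rV[R]_n) (i : 'I_n) : z (y *m A) 0 i = toC s`_i * z y 0 i.
  by rewrite /z map_mxM -mulmxA AU mulmxA mul_mx_diag !mxE mulrC.
pose w i := complex.Re (z x 0 i * (z x 0 i)^*).
have wE i : toC (w i) = z x 0 i * (z x 0 i)^*.
  by apply: RRe_real; apply: ger0_real; apply: mul_conjC_ge0.
exists w; split=> [i|||u i u0 uA xu lt10 lt1i].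
- by rewrite -lecR wE mul_conjC_ge0.
- apply: complexI; rewrite zz rmorph_sum.
  by apply: eq_bigr => i _; rewrite /= wE.
- apply: complexI; rewrite zz rmorph_sum.
  by apply: eq_bigr => i _; rewrite zA /= rmorphM /= wE mulrA.
(* Comparing coordinates in [u *m A = s_0 u] gives [(s_0 - s_j) z_j = 0], and [s_j <= s_1 < s_0] for
   positive [j]. So [u] lies along the first basis vector alone. *)
have zu0 (j : 'I_n) : (0 < j)%N -> z u 0 j = 0.
  move=> j0; have /eqP := zA u j; rewrite uA /z map_mxZ -scalemxAl mxE -/(z u).
  rewrite -subr_eq0 -mulrBl mulf_eq0 => /orP[|/eqP//].
  rewrite -rmorphB fmorph_eq0 subr_eq0 => /eqP s0j.
  have : s`_j <= s`_1 by rewrite (ordered_spectrum_nth_le specA) // j0 /=.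
  by rewrite -s0j leNgt lt10.
have i0 : i = 0%N :> nat.
  apply/eqP; rewrite -leqn0 leqNgt; apply: contraTN lt1i => i_gt0.
  by rewrite -leNgt (ordered_spectrum_nth_le specA) // i_gt0 /=.
have zsum (y : 'rV[R]_n) : toC ((y *m u^T) 0 0) = z y 0 i * (z u 0 i)^*.
  rewrite zz (bigD1 i) //= big1 ?addr0 // => j ji.
  rewrite zu0 ?rmorph0 ?mulr0 // lt0n; apply: contraNneq ji => j0.
  by apply/eqP/val_inj; rewrite /= j0 i0.
(* With a single coordinate left, its vanishing would make the sum of squares of the entries of [u]
   zero. Then [x *m u^T = 0] forces the coordinate of [x] at [i] to vanish. *)
have zui : z u 0 i != 0.
  apply: contraNneq u0 => zui0; apply/eqP/rowP => j; rewrite [RHS]mxE.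
  have /eqP := zsum u; rewrite zui0 mul0r fmorph_eq0 mxE.
  rewrite psumr_eq0 => [/allP/(_ j (mem_index_enum _))|k _].
    by rewrite mxE mulf_eq0 orbb => /eqP.
  by rewrite mxE -expr2 sqr_ge0.
apply: complexI; rewrite wE.
have /eqP := zsum x; rewrite xu mxE rmorph0 eq_sym mulf_eq0 conjC_eq0.
by rewrite (negbTE zui) orbF => /eqP->; rewrite mul0r.
Qed.

Lemma rayleigh_min (x : 'rV[R]_n) :
  s`_n.-1 * (x *m x^T) 0 0 <= (x *m A *m x^T) 0 0.
Proof.
have [w [w0 -> -> _]] := rayleigh_weights x.
rewrite mulr_sumr; apply: ler_sum => i _; apply: ler_wpM2r => //.
have n0 : (0 < n)%N by apply: leq_ltn_trans (ltn_ord i).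
by rewrite (ordered_spectrum_nth_le specA) // -ltnS prednK // ltn_ord /=.
Qed.

(* If s_1 = s_0 this is the trivial bound by the largest eigenvalue; otherwise
   s_0 is simple, u spans its eigenspace and x has no component along it. *)
Lemma rayleigh_second (u x : 'rV[R]_n) :
    u != 0 -> u *m A = s`_0 *: u -> x *m u^T = 0 ->
  (x *m A *m x^T) 0 0 <= s`_1 * (x *m x^T) 0 0.
Proof.
move=> u0 uA xu; have [w [w0 -> -> wP]] := rayleigh_weights x.
rewrite mulr_sumr; apply: ler_sum => i _.
have [le_i1|lt_1i] := leP s`_i s`_1; first exact: ler_wpM2r.
have le_i0 : s`_i <= s`_0 by rewrite (ordered_spectrum_nth_le specA) /=.
by rewrite (wP u i) ?mulr0 // (lt_le_trans lt_1i).
Qed.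

End Rayleigh.

(** * Eigenvalues of nonnegative matrices with constant row sums *)

Lemma eigenvalue_le_row_sum (R : realFieldType) (n : nat) (A : 'M[R]_n)
    (a d : R) :
    (forall i j, 0 <= A i j) -> (forall i, \sum_j A i j = d) ->
  eigenvalue A a -> a <= d.
Proof.
move=> A0 Ad /eigenvalueP[v vA v0].
have norm_gt0 : 0 < \sum_i `|v 0 i|.
  rewrite lt_neqAle sumr_ge0 // andbT eq_sym; apply: contraNneq v0 => sum0.
  apply/eqP/rowP => j; have /eqP := sum0; rewrite psumr_eq0 // mxE.
  by move=> /allP/(_ j (mem_index_enum _)); rewrite normr_eq0 => /eqP.
(* Sum the absolute values in [v *m A = a *: v]: after the triangle inequality and an exchange of
   sums, each [|v_j|] is weighted by its row sum [d]. Cancel the positive sum of the [|v_j|]. *)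
rewrite (le_trans (ler_norm a)) // -(ler_pM2r norm_gt0) !mulr_sumr.
apply: (@le_trans _ _ (\sum_i \sum_j `|v 0 j| * A j i)).
  apply: ler_sum => i _; have /rowP/(_ i) := vA; rewrite !mxE -normrM => <-.
  apply: le_trans (ler_norm_sum _ _ _) _; apply: ler_sum => j _.
  by rewrite normrM (ger0_norm (A0 _ _)).
rewrite exchange_big; apply: ler_sum => j _ /=.
by rewrite -mulr_sumr Ad mulrC.
Qed.

(** * Symmetry and diagonal of the distance *)

Lemma gdistC (T : finType) (e : rel T) : symmetric e ->
  forall u v, gdist e u v = gdist e v u.
Proof.
move=> e_sym u v; apply: eq_find => k.
suff walkC (x y : T) : [exists p : k.-tuple T, path e x p && (last x p == y)] ->
    [exists p : k.-tuple T, path e y p && (last y p == x)].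
  by apply/idP/idP; apply: walkC.
move=> /existsP[p /andP[ep /eqP lp]]; apply/existsP.
(* The reversal of the walk [x :: p] starts at [last x p]; removing that head leaves
   [rev (belast x p)], with as many edges as [p]. *)
have szq : size (rev (belast x p)) == k.
  by rewrite size_rev size_belast size_tuple.
exists (Tuple szq); rewrite /= -lp rev_path.
rewrite (@eq_path _ _ e) ?ep /=; last by move=> a b; rewrite /= e_sym.
by case: (tval p) => //= a q; rewrite rev_cons last_rcons.
Qed.

Lemma gdistxx (T : finType) (e : rel T) (u : T) : gdist e u u = 0%N.
Proof.
rewrite /gdist; have : (0 < #|T|)%N by apply/card_gt0P; exists u.
case: #|T| => //= n _; case: ifP => // /existsP[]; exists [tuple] => /=.
by rewrite eqxx.
Qed.

(** * Quadratic forms at the centred indicator vector *)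

Section CentredIndicator.
Variables (R : realFieldType) (n : nat) (A : 'M[R]_n) (d t : R).
Variable S : {set 'I_n}.
Hypotheses (n_gt0 : (0 < n)%N) (symA : A^T = A)
  (rowA : forall i, \sum_j A i j = d) (diagA : forall i, A i i = 0)
  (SA : {in S &, forall i j, i != j -> A i j = t}).

Let u : 'rV[R]_n := const_mx 1.
Let x : 'rV[R]_n := \row_i (i \in S)%:R.
Let m : R := #|S|%:R.
Let y := x - (m / n%:R) *: u.

Lemma const_mx1_eigen : u *m A = d *: u.
Proof.
apply/rowP => i; rewrite !mxE mulr1 -(rowA i).
by apply: eq_bigr => j _; rewrite mxE mul1r -[in LHS]symA mxE.
Qed.

Let xu : (x *m u^T) 0 0 = m.
Proof.
rewrite mxE /m -sum1_card natr_sum [RHS]big_mkcond /=.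
by apply: eq_bigr => i _; rewrite !mxE mulr1; case: (i \in S).
Qed.

Let uu : (u *m u^T) 0 0 = n%:R.
Proof.
rewrite mxE (eq_bigr (fun=> 1)) => [|i _]; last by rewrite !mxE mulr1.
by rewrite sumr_const card_ord.
Qed.

Let xx : (x *m x^T) 0 0 = m.
Proof.
rewrite -xu !mxE; apply: eq_bigr => i _; rewrite !mxE mulr1.
by case: (i \in S); rewrite ?mulr1 ?mulr0.
Qed.

Let xAx : (x *m A *m x^T) 0 0 = t * m * (m - 1).
Proof.
have -> : t * m * (m - 1) = \sum_(i in S) t * (m - 1).
  by rewrite sumr_const -mulr_natr -/m; ring.
rewrite mxE [RHS]big_mkcond; apply: eq_bigr => i _; rewrite /= !mxE.
case: ifP => iS; last by rewrite mulr0.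
rewrite mulr1 (eq_bigr (fun j => if j \in S then A j i else 0)); last first.
  by move=> j _; rewrite !mxE; case: ifP => _; rewrite ?mul1r ?mul0r.
(* The zero diagonal removes [j = i]; each of the other [m - 1] members of [S] contributes [t]. *)
rewrite -big_mkcond (bigD1 i) //= diagA add0r.
rewrite (eq_bigr (fun=> t)) => [|j /andP[jS ji]]; last exact: SA.
have -> : m - 1 = \sum_(j in S | j != i) 1.
  rewrite /m -sum1_card natr_sum (bigD1 i) //= addrAC subrr add0r.
  by apply: eq_bigr.
by rewrite mulr_sumr; apply: eq_bigr => j _; rewrite mulr1.
Qed.

Let n0 : n%:R != 0 :> R.
Proof. by rewrite pnatr_eq0 -lt0n. Qed.

Lemma centred_orth : y *m u^T = 0.
Proof.
rewrite /y mulmxBl -scalemxAl [x *m _]mx11_scalar [u *m _]mx11_scalar xu uu.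
by rewrite scale_scalar_mx divfK // subrr.
Qed.

(** In the right factor [y] may be replaced by [x], since they differ by a multiple of [u], to which
    [y] is orthogonal. *)
Lemma centred_norm : (y *m y^T) 0 0 = m - m ^+ 2 / n%:R.
Proof.
rewrite {2}/y linearB linearZ /= mulmxBr -scalemxAr centred_orth scaler0 subr0.
rewrite /y mulmxBl -scalemxAl mxE xx 2!mxE.
have -> : (u *m x^T) 0 0 = m by rewrite -xu -[u *m _]trmxK trmx_mul trmxK mxE.
by field.
Qed.

Lemma centred_form : (y *m A *m y^T) 0 0 = t * m * (m - 1) - d * m ^+ 2 / n%:R.
Proof.
have uAT : A *m u^T = d *: u^T.
  by rewrite -linearZ /= -const_mx1_eigen trmx_mul symA.
(* Again [x] replaces [y] on the right, because [A] sends [u^T] to a multiple of itself. *)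
rewrite {2}/y linearB linearZ /= mulmxBr -scalemxAr -[y *m A *m u^T]mulmxA uAT.
rewrite -scalemxAr centred_orth !scaler0 subr0.
rewrite /y 2!mulmxBl -2!scalemxAl const_mx1_eigen -scalemxAl mxE xAx 3!mxE.
have -> : (u *m x^T) 0 0 = m by rewrite -xu -[u *m _]trmxK trmx_mul trmxK mxE.
by field.
Qed.

End CentredIndicator.

(** * The two bounds on equidistant sets *)

Theorem theorem25 (R : rcfType) (t : nat) (T : finType) (e : rel T) (d : R)
    (lam : seq R)
    (t_ge1 : (1 <= t)%N)
    (n_ge2 : (2 <= #|T|)%N)
    (e_sym : symmetric e)
    (e_irr : irreflexive e)
    (e_conn : connected_graph e)
    (e_reg : transmission_regular e d)
    (lam_spec : ordered_spectrum (distance_mx R e) lam) :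
  (0 < t%:R * #|T|%:R - d + lam`_1 ->
     (eq_num e t)%:R <=
       (lam`_1 + t%:R) * #|T|%:R / (t%:R * #|T|%:R - d + lam`_1))
  /\
  (t%:R * #|T|%:R - d + lam`_(#|T|.-1) < 0 ->
     (eq_num e t)%:R <=
       (lam`_(#|T|.-1) + t%:R) * #|T|%:R
         / (t%:R * #|T|%:R - d + lam`_(#|T|.-1))).
Proof.
have n_gt0 : (0 < #|T|)%N by apply: ltnW.
(* Singletons show that the maximum is attained and at least 1, so that dividing by [m] is
   legitimate. *)
have equi1 (a : T) : equidistant e t [set a].
  apply/forall_inP => u /set1P ->; apply/forall_inP => v /set1P ->.
  by rewrite eqxx.
have [a _] : exists a, a \in T by apply/card_gt0P.
have [S equiS eqS] : exists2 S, equidistant e t S & eq_num e t = #|S|.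
  rewrite /eq_num; have [|S] := @eq_bigmax_cond _ (equidistant e t)
    (fun S : {set T} => #|S|); last by move=> ? ?; exists S.
  by apply/card_gt0P; exists [set a]; apply: equi1.
have S_gt0 : (0 < #|S|)%N.
  by rewrite -eqS -(cards1 a) (leq_bigmax_cond _ (equi1 a)).
set A := distance_mx R e in lam_spec.
have symA : A^T = A by apply/matrixP => i j; rewrite !mxE gdistC.
have rowA : forall i, \sum_j A i j = d := e_reg.
have diagA i : A i i = 0 by rewrite mxE gdistxx.
pose S' := enum_rank @: S.
have cardS' : #|S'| = #|S| by apply/card_imset/enum_rank_inj.
have SA : {in S' &, forall i j, i != j -> A i j = t%:R}.
  move=> _ _ /imsetP[v vS ->] /imsetP[w wS ->]; rewrite (inj_eq enum_rank_inj).
  move=> vw; rewrite mxE !enum_rankK; move/forall_inP: equiS => /(_ v vS).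
  by move=> /forall_inP/(_ w wS); rewrite vw => /eqP->.
have u0 : const_mx 1 != 0 :> 'rV[R]_#|T|.
  apply/eqP => /rowP/(_ (Ordinal n_gt0)); rewrite !mxE => /eqP.
  by rewrite oner_eq0.
have uA := const_mx1_eigen symA rowA.
(* No eigenvalue exceeds the row sum [d], and [d] itself occurs in [lam] through the all-ones
   eigenvector. *)
have lam0 : lam`_0 = d.
  have sz := size_ordered_spectrum lam_spec.
  apply/eqP; rewrite eq_le; apply/andP; split.
    apply: (eigenvalue_le_row_sum _ rowA) => [i j|]; first by rewrite mxE.
    by rewrite (mem_ordered_spectrum _ lam_spec) mem_nth ?sz.
  have : d \in lam.
    rewrite -(mem_ordered_spectrum _ lam_spec); apply/eigenvalueP.
    by exists (const_mx 1).
  move=> /(nthP 0)[k]; rewrite sz => k_lt <-.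
  by rewrite (ordered_spectrum_nth_le lam_spec).
have n_R : 0 < #|T|%:R :> R by rewrite ltr0n.
have m_R : 0 < #|S|%:R :> R by rewrite ltr0n.
have orth := centred_orth R S' n_gt0.
have norm_y := centred_norm R S' n_gt0.
have form_y := centred_form n_gt0 symA rowA diagA SA.
rewrite cardS' in orth norm_y form_y; rewrite eqS.
move: n_R m_R norm_y form_y orth.
set n : R := #|T|%:R; set m : R := #|S|%:R => n_R m_R norm_y form_y orth.
(* With [c] the second largest or the smallest eigenvalue, the gap in the Rayleigh bound, scaled by
   [n], factors through [m]. The sign of the other factor is the claim before dividing by the
   denominator. *)
have key c : n * (t%:R * m * (m - 1) - d * m ^+ 2 / n - c * (m - m ^+ 2 / n))
    = m * (m * (t%:R * n - d + c) - (c + t%:R) * n).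
  by field; rewrite gt_eqF.
split=> [den_gt0|den_lt0].
- have := rayleigh_second symA lam_spec u0 _ orth.
  rewrite lam0 => /(_ uA); rewrite norm_y form_y -subr_le0.
  rewrite -(pmulr_rle0 _ n_R) key (pmulr_rle0 _ m_R) subr_le0.
  by rewrite ler_pdivlMr.
(* The lower Rayleigh bound gives the opposite sign, and division by the negative denominator turns
   it back into an upper bound on [m]. *)
- have := rayleigh_min symA lam_spec
    (\row_i (i \in S')%:R - (m / n) *: const_mx 1).
  rewrite norm_y form_y -subr_ge0.
  rewrite -(pmulr_rge0 _ n_R) key (pmulr_rge0 _ m_R) subr_ge0.
  by rewrite ler_ndivlMr.
Qed.
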